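(* $\mathcal{S}_P\subseteq\mathcal{S}_F\subseteq\mathcal{S}_C\subseteq\mathcal{D}^-$.
   Context: For a distribution function $G$, $G^{-1}(u)=\inf\{x\in\mathbb{R}:G(x)\ge u\}$ for $0<u<1$. For distribution functions $F,G$, write $F\le_{skew}G$ if the function $x\mapsto G^{-1}(F(x))$ is convex (on the set of $x$ with $0<F(x)<1$). For a distribution function $F$, $\mathcal{S}(F)=\{G: F\le_{skew}G\}$. Set $\mathcal{S}_P=\mathcal{S}(F_P)$ with $F_P(x)=1-1/x$, $x\ge1$ (Pareto(1)); $\mathcal{S}_F=\mathcal{S}(F_F)$ with $F_F(x)=e^{-1/x}$, $x>0$ (standard Fréchet); $\mathcal{S}_C=\mathcal{S}(F_C)$ with $F_C(x)=\frac1\pi\arctan(x)+\frac12$, $x\in\mathbb{R}$ (Cauchy). For real random variables, $X \le_{st} Y$ means $P(X\le t)\ge P(Y\le t)$ for all $t\in\mathbb{R}$. A distribution function $F_X$ belongs to $\mathcal{D}^-$ if for every $n\in\mathbb{N}$, all $\theta_1,\dots,\theta_n\ge 0$ with $\sum_{i=1}^n\theta_i=1$, and i.i.d. random variables $X_1,\dots,X_n$ with distribution $F_X$, we have $X_1\le_{st}\sum_{i=1}^n\theta_iX_i$. *)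

(* Defs.v *)
From HB Require Import structures.
From mathcomp Require Import all_boot all_order all_algebra.
From mathcomp Require Import all_classical all_reals all_analysis.
Set Implicit Arguments. Unset Strict Implicit. Unset Printing Implicit Defensive.
Import Order.TTheory GRing.Theory Num.Theory.
Import numFieldNormedType.Exports.
Local Open Scope classical_set_scope.
Local Open Scope ring_scope.

Section Defs.
Variable R : realType.

Definition is_distribution_function (G : R -> R) : Prop :=
  [/\ {homo G : x y / x <= y},
      (forall y, G x @[x --> y^'+] --> G y),
      G x @[x --> -oo] --> (0:R) & G x @[x --> +oo] --> (1:R)].

Definition ginv (G : R -> R) (u : R) : R := inf [set x | u <= G x].

Definition convex_on (S : set R) (f : R -> R) : Prop :=
  forall x y t, S x -> S y -> 0 <= t -> t <= 1 ->
    f (t * x + (1 - t) * y) <= t * f x + (1 - t) * f y.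

Definition skew_le (F G : R -> R) : Prop :=
  convex_on [set x | 0 < F x < 1] (fun x => ginv G (F x)).

Definition skew_class (F : R -> R) : set (R -> R) :=
  [set G | is_distribution_function G /\ skew_le F G].

Definition F_Pareto (x : R) : R := if 1 <= x then 1 - x^-1 else 0.
Definition F_Frechet (x : R) : R := if 0 < x then expR (- x^-1) else 0.
Definition F_Cauchy (x : R) : R := pi^-1 * atan x + 2^-1.

Definition S_P := skew_class F_Pareto.
Definition S_F := skew_class F_Frechet.
Definition S_C := skew_class F_Cauchy.

Definition mutually_independent d (T : measurableType d) (P : probability T R)
  (n : nat) (X : 'I_n -> {RV P >-> R}) : Prop :=
  forall B : 'I_n -> set R, (forall i, measurable (B i)) ->
    P (\bigcap_(i in [set: 'I_n]) (X i @^-1` B i)) =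
    (\prod_(i < n) P (X i @^-1` B i))%E.

Definition has_cdf d (T : measurableType d) (P : probability T R)
  (X : T -> R) (F : R -> R) : Prop :=
  forall t, P [set w | X w <= t] = (F t)%:E.

Definition st_le d (T : measurableType d) (P : probability T R)
  (X Y : T -> R) : Prop :=
  forall t, (P [set w | (Y w <= t)%R] <= P [set w | (X w <= t)%R])%E.

Definition D_minus (F : R -> R) : Prop :=
  forall (n : nat) (theta : 'I_n.+1 -> R),
    (forall i, 0 <= theta i) -> \sum_(i < n.+1) theta i = 1 ->
    forall d (T : measurableType d) (P : probability T R)
      (X : 'I_n.+1 -> {RV P >-> R}),
      mutually_independent X -> (forall i, has_cdf P (X i) F) ->
      st_le P (X ord0) (fun w => \sum_(i < n.+1) theta i * X i w).

End Defs.

(* Main.v *)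
Require Import Defs.
From HB Require Import structures.
From mathcomp Require Import all_boot all_order all_algebra.
From mathcomp Require Import all_classical all_reals all_analysis.
From mathcomp Require Import measurable_realfun.
From mathcomp Require Import ring lra.
Local Open Scope classical_set_scope.

(* If [F1 = F2 \o phi] with [phi] convex and [G^-1 \o F2] convex, then
   [G^-1 \o F1] is convex, because [G^-1 \o F2] is also nondecreasing. So the
   two first inclusions amount to the convexity of [F_P^-1 \o F_F] and of
   [F_F^-1 \o F_C], which is read off the second derivatives.

   For the last inclusion write [h = G^-1 \o F_C]. If [C], [C'] are independent
   Cauchy variables and [a + b = 1], then
   [a * h C + b * h C' >= h (a * C + b * C')] by convexity, and
   [a * C + b * C'] is again Cauchy; so the weighted mean of two independent
   variables of law [G] stochastically dominates [G]. The two variables may be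
   replaced by any independent variables dominating [G], hence longer convex
   combinations are treated by merging two terms at a time. *)

Set Implicit Arguments.
Unset Strict Implicit.
Unset Printing Implicit Defensive.
Import Order.TTheory GRing.Theory Num.Theory.
Import numFieldNormedType.Exports.
Local Open Scope ring_scope.

(** * Generalized inverses of distribution functions *)

Section ginv.
Context {R : realType}.
Implicit Types (F G : R -> R) (u t : R).

(** The limit [1] at [+oo] gives a point of the set because [u < 1]; the limit [0] at [-oo] bounds
    the set below because [0 < u]. *)
Lemma ginv_has_inf G u : is_distribution_function G -> 0 < u < 1 ->
  has_inf [set x | u <= G x].
Proof.
move=> [Gnd _ GNy Gy] /andP[u0 u1]; split.
  have : \forall x \near +oo, u <= G x by apply: (cvgr_ge _ Gy).
  by move=> /pinfty_ex_gt0[x _ ux]; exists x.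
have : \forall x \near -oo, G x < u by apply: (cvgr_lt _ GNy).
case=> M [_ H]; exists (M - 1) => y uy; rewrite leNgt; apply/negP => yM.
have : G y < u by apply: H; rewrite (lt_le_trans yM)// gerBl.
by rewrite ltNge uy.
Qed.

Lemma ginv_nd G u v : is_distribution_function G ->
  0 < u -> u <= v -> v < 1 -> ginv G u <= ginv G v.
Proof.
move=> Gd u0 uv v1; have u1 := le_lt_trans uv v1; have v0 := lt_le_trans u0 uv.
have u01 : 0 < u < 1 by rewrite u0.
have v01 : 0 < v < 1 by rewrite v0.
have [ne _] := ginv_has_inf Gd v01; have [_ lb] := ginv_has_inf Gd u01.
by apply: lb_le_inf => // x /(le_trans uv); exact: ge_inf.
Qed.

(** Right continuity makes the infimum attained: each [y] above [ginv G u] exceeds a point of the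
    set, so [u <= G y], and [y] then tends to [ginv G u] from the right. *)
Lemma ginv_leP G u t : is_distribution_function G -> 0 < u < 1 ->
  (ginv G u <= t) = (u <= G t).
Proof.
move=> Gd u01; have [ne lb] := ginv_has_inf Gd u01.
have [Gnd Grc _ _] := Gd.
apply/idP/idP => [gt|ut]; last exact: ge_inf.
suff: u <= G (ginv G u) by move/le_trans; apply; exact: Gnd.
apply: (cvgr_to_ge (Grc _)); near=> y.
have : ginv G u < y by near: y; exact: nbhs_right_gt.
by move=> /(inf_lt ne)[z uz /ltW/Gnd]; exact: le_trans.
Unshelve. all: end_near. Qed.

End ginv.

(** * Derivatives, monotonicity and convexity *)

Section derivatives.
Context {R : realType}.
Implicit Types (f g : R -> R) (x a b : R).

(* The rules of [derive.v] restated for lambda abstractions, so that a derivative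
   can be computed by nesting them. *)
Lemma dfun_cst c x : is_derive x (1 : R) (fun=> c) (0 : R).
Proof. exact: is_derive_cst. Qed.

Lemma dfun_id x : is_derive x (1 : R) (fun y : R => y) (1 : R).
Proof. exact: is_derive_id. Qed.

Lemma dfunD f g x a b : is_derive x 1 f a -> is_derive x 1 g b ->
  is_derive x (1 : R) (fun y => f y + g y) (a + b).
Proof. exact: is_deriveD. Qed.

Lemma dfunN f x a : is_derive x 1 f a ->
  is_derive x (1 : R) (fun y => - f y) (- a).
Proof. exact: is_deriveN. Qed.

Lemma dfunM f g x a b : is_derive x 1 f a -> is_derive x 1 g b ->
  is_derive x (1 : R) (fun y => f y * g y) (f x * b + g x * a).
Proof. exact: is_deriveM. Qed.

Lemma dfunV f x a : f x != 0 -> is_derive x 1 f a ->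
  is_derive x (1 : R) (fun y => (f y)^-1) (- (f x) ^- 2 * a).
Proof. by move=> fx fa; have := is_deriveV fx fa. Qed.

Lemma dfunX f n x a : is_derive x 1 f a ->
  is_derive x (1 : R) (fun y => f y ^+ n) (n%:R * f x ^+ n.-1 * a).
Proof. by move=> fa; have := is_deriveX n fa; rewrite exprfctE. Qed.

Lemma dfun_expR f x a : is_derive x 1 f a ->
  is_derive x (1 : R) (fun y => expR (f y)) (expR (f x) * a).
Proof. by move=> fa; exact: (is_derive1_comp (is_derive_expR (f x)) fa). Qed.

Lemma dfun_ln f x a : 0 < f x -> is_derive x 1 f a ->
  is_derive x (1 : R) (fun y => ln (f y)) ((f x)^-1 * a).
Proof. by move=> f0 fa; exact: (is_derive1_comp (is_derive1_ln f0) fa). Qed.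

Lemma dfun_atan f x a : is_derive x 1 f a ->
  is_derive x (1 : R) (fun y => atan (f y)) ((1 + f x ^+ 2)^-1 * a).
Proof. by move=> fa; exact: (is_derive1_comp (is_derive1_atan (f x)) fa). Qed.

Lemma dfun_sin f x a : is_derive x 1 f a ->
  is_derive x (1 : R) (fun y => sin (f y)) (cos (f x) * a).
Proof. by move=> fa; exact: (is_derive1_comp (is_derive_sin (f x)) fa). Qed.

Lemma dfun_cos f x a : is_derive x 1 f a ->
  is_derive x (1 : R) (fun y => cos (f y)) (- sin (f x) * a).
Proof. by move=> fa; exact: (is_derive1_comp (is_derive_cos (f x)) fa). Qed.

Lemma dfun_continuous f x a : is_derive x 1 f a -> {for x, continuous f}.
Proof.
by move=> [? _]; apply: differentiable_continuous; exact/derivable1_diffP.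
Qed.

Lemma interval_conv (S : set R) x y t : is_interval S -> S x -> S y ->
  0 <= t -> t <= 1 -> S (t * x + (1 - t) * y).
Proof.
move=> iS Sx Sy t0 t1; have [xy|/ltW yx] := leP x y.
  by apply: (iS x y) => //; apply/andP; split; nra.
by apply: (iS y x) => //; apply/andP; split; nra.
Qed.

Lemma derive_nd (S : set R) f f' : is_interval S ->
  (forall x, S x -> is_derive x 1 f (f' x)) ->
  (forall x, S x -> 0 <= f' x) ->
  forall x y, S x -> S y -> x <= y -> f x <= f y.
Proof.
move=> iS df f'0 x y Sx Sy xy.
have Sz z : z \in `[x, y] -> S z.
  by rewrite in_itv/= => zxy; exact: (iS x y).
have [z zxy||z zxy e] := @MVT_segment R f f' x y xy.
- by apply/df/Sz; exact: subset_itv_oo_cc zxy.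
- by apply: derivable_within_continuous => z /Sz /df[].
- by rewrite -subr_ge0 e mulr_ge0 ?subr_ge0//; apply/f'0/Sz.
Qed.

(** A nondecreasing derivative puts [f] above its tangent at [z]; averaging the tangent inequalities
    at [x] and [y] gives convexity. *)
Lemma derive2_convex (S : set R) f f' f'' : is_interval S ->
  (forall x, S x -> is_derive x 1 f (f' x)) ->
  (forall x, S x -> is_derive x 1 f' (f'' x)) ->
  (forall x, S x -> 0 <= f'' x) -> convex_on S f.
Proof.
move=> iS df df' f''0 x y t Sx Sy t0 t1.
have f'nd := derive_nd iS df' f''0.
set z := t * x + (1 - t) * y.
have Sz : S z by exact: interval_conv.
have tangent w : S w -> f z + f' z * (w - z) <= f w.
  move=> Sw.
  (* [g] has derivative [f' v - f' z], so it is least at [z]; on the left of [z] this is the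
     monotonicity of [- g]. *)
  pose g v := f v - f' z * v.
  have dg v : S v -> is_derive v 1 g (f' v - f' z).
    move=> Sv.
    apply: (is_derive_eq (dfunD (df _ Sv) (dfunN (dfunM (dfun_cst _ _) (dfun_id v))))).
    by rewrite mulr0 addr0 mulr1.
  suff : g z <= g w by rewrite /g; lra.
  have [zw|/ltW wz] := leP z w.
    apply: (@derive_nd [set v | S v /\ z <= v] g (fun v => f' v - f' z)) => //.
    - move=> a b [Sa za] [Sb zb] c acb; split; first exact: (iS a b).
      by case/andP: acb => /(le_trans za).
    - by move=> v [/dg].
    - by move=> v [Sv zv]; rewrite subr_ge0 f'nd.
  rewrite -lerN2.
  apply: (@derive_nd [set v | S v /\ v <= z] (fun v => - g v) (fun v => - (f' v - f' z))) => //.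
  - move=> a b [Sa za] [Sb zb] c acb; split; first exact: (iS a b).
    by case/andP: acb => _ /le_trans; apply.
  - by move=> v [/dg dgv _]; exact: dfunN.
  - by move=> v [Sv zv]; rewrite oppr_ge0 subr_le0 f'nd.
have := tangent _ Sx; have := tangent _ Sy.
move=> /(ler_wpM2l (_ : 0 <= 1 - t)) hy /(ler_wpM2l t0) hx.
have {}hy := hy ltac:(by rewrite subr_ge0).
(* The slope terms cancel, as [t * (x - z) + (1 - t) * (y - z) = 0]. *)
have -> : f z = t * (f z + f' z * (x - z)) + (1 - t) * (f z + f' z * (y - z)).
  by rewrite /z; ring.
exact: lerD.
Qed.

End derivatives.

(** * Comparison of skewness classes *)

Section skew.
Context {R : realType}.
Implicit Types (F G : R -> R) (u t : R).

Lemma nd_is_interval01 F : {homo F : x y / x <= y} ->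
  is_interval [set x | 0 < F x < 1].
Proof.
move=> Fnd x y /andP[Fx0 _] /andP[_ Fy1] z /andP[/Fnd xz /Fnd zy] /=.
by rewrite (lt_le_trans Fx0)// (le_lt_trans zy).
Qed.

(** [phi] carries the set where [0 < F1 < 1] into the set where [0 < F2 < 1]. Both sets are
    intervals, so all convex combinations stay where [ginv] is monotone. *)
Lemma skew_class_sub F1 F2 (phi : R -> R) :
  {homo F1 : x y / x <= y} -> {homo F2 : x y / x <= y} ->
  (forall x, 0 < F1 x < 1 -> F2 (phi x) = F1 x) ->
  convex_on [set x | 0 < F1 x < 1] phi ->
  skew_class F2 `<=` skew_class F1.
Proof.
move=> F1nd F2nd phiE phicvx G [Gd FG]; split => // x y t Fx Fy t0 t1.
have Fz := interval_conv (nd_is_interval01 F1nd) Fx Fy t0 t1.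
have [F2x F2y] : 0 < F2 (phi x) < 1 /\ 0 < F2 (phi y) < 1 by rewrite !phiE.
have F2w := interval_conv (nd_is_interval01 F2nd) F2x F2y t0 t1.
rewrite -(phiE _ Fz) -(phiE _ Fx) -(phiE _ Fy).
apply: le_trans (FG _ _ _ F2x F2y t0 t1); apply: ginv_nd => //.
- by rewrite phiE//; case/andP: Fz.
- by apply: F2nd; exact: phicvx.
- by case/andP: F2w.
Qed.

Lemma F_Pareto_nd : {homo @F_Pareto R : x y / x <= y}.
Proof.
move=> x y xy; rewrite /F_Pareto; case: ifPn => x1.
  rewrite (le_trans x1 xy) lerD2l lerN2 lef_pV2// posrE; lra.
case: ifPn => // y1; rewrite subr_ge0 invf_le1//; lra.
Qed.

Lemma F_Frechet_nd : {homo @F_Frechet R : x y / x <= y}.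
Proof.
move=> x y xy; rewrite /F_Frechet; case: ifPn => x0.
  by rewrite (lt_le_trans x0 xy) ler_expR lerN2 lef_pV2// posrE; lra.
by case: ifPn => // _; exact: expR_ge0.
Qed.

Lemma F_Cauchy_nd : {homo @F_Cauchy R : x y / x <= y}.
Proof.
move=> x y xy; rewrite /F_Cauchy lerD2r ler_wpM2l ?invr_ge0 ?pi_ge0//.
exact: le_atan.
Qed.

Lemma F_Cauchy01 (x : R) : 0 < F_Cauchy x < 1.
Proof.
have p0 : 0 < pi^-1 :> R by rewrite invr_gt0 pi_gt0.
have pV : pi^-1 * (pi / 2) = 2^-1 :> R by rewrite mulKf// gt_eqF// pi_gt0.
have := atan_gtNpi2 x; rewrite -(ltr_pM2l p0) mulrN pV => h1.
have := atan_ltpi2 x; rewrite -(ltr_pM2l p0) pV => h2.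
by rewrite /F_Cauchy; apply/andP; split; lra.
Qed.

Lemma F_Frechet01 (x : R) : (0 < F_Frechet x < 1) = (0 < x).
Proof.
rewrite /F_Frechet; case: ifPn => x0; last by rewrite ltxx.
by rewrite expR_gt0 expR_lt1 oppr_lt0 invr_gt0.
Qed.


End skew.

(** * Convexity of the transfer maps *)

Section frechet_pareto.
Context {R : realType}.
Implicit Types (x s : R).

Lemma ray_is_interval : is_interval [set x : R | 0 < x].
Proof. by move=> x y /= x0 _ z /andP[/(lt_le_trans x0)]. Qed.

(* [tanh (s / 2) <= s / 2] *)
Lemma tanh_le s : 0 <= s -> 2 * (1 - expR (- s)) <= s * (1 + expR (- s)).
Proof.
move=> s0; rewrite -subr_ge0.
pose f s := s * (1 + expR (- s)) + (-2) * (1 + - expR (- s)).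
have f0 : f 0 = 0 by rewrite /f oppr0 expR0; ring.
suff : f 0 <= f s by rewrite f0 /f; lra.
(* This derivative is nonnegative because [1 + s <= expR s]. *)
apply: (@derive_nd R [set x | 0 <= x] f (fun s => 1 - (1 + s) * expR (- s))) => //=.
- by move=> x y /= x0 _ z /andP[/(le_trans x0)].
- move=> x _; have dE := dfun_expR (dfunN (dfun_id x)).
  apply: (is_derive_eq (dfunD (dfunM (dfun_id x) (dfunD (dfun_cst 1 _) dE))
    (dfunM (dfun_cst (-2) _) (dfunD (dfun_cst 1 _) (dfunN dE))))).
  ring.
- move=> x x0; rewrite subr_ge0 expRN ler_pdivrMr ?expR_gt0// mul1r.
  exact: expR_ge1Dx.
Qed.

(* [F_P^-1 \o F_F] *)
Let phi x : R := (1 - expR (- x^-1))^-1.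

(** With [s = x^-1], the second derivative has the sign of [s * (1 + expR (- s)) - 2 * (1 - expR (-
    s))], which [tanh_le] settles. *)
Lemma frechet_pareto_convex : convex_on [set x : R | 0 < x] phi.
Proof.
pose E x : R := expR (- x^-1).
have E1 x : 0 < x -> 1 - E x != 0.
  by move=> x0; rewrite gt_eqF// subr_gt0 expR_lt1 oppr_lt0 invr_gt0.
have dE x : 0 < x -> is_derive x 1 E (E x / x ^+ 2).
  move=> x0; have xn0 : x != 0 by rewrite gt_eqF.
  apply: (is_derive_eq (dfun_expR (dfunN (dfunV xn0 (dfun_id x))))).
  by rewrite /E; field.
pose D x : R := x ^+ 2 * (1 - E x) ^+ 2.
have dD x : 0 < x -> is_derive x 1 D
    (2 * x * (1 - E x) ^+ 2 - 2 * (1 - E x) * E x).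
  move=> x0; have xn0 : x != 0 by rewrite gt_eqF.
  apply: (is_derive_eq (dfunM (dfunX 2 (dfun_id x))
    (dfunX 2 (dfunD (dfun_cst 1 _) (dfunN (dE _ x0)))))).
  by field.
apply: (@derive2_convex R _ phi (fun x => E x / D x)
  (fun x => E x * (x^-1 * (1 + E x) - 2 * (1 - E x)) / (x ^+ 3 * (1 - E x) ^+ 3))).
- exact: ray_is_interval.
- move=> x /= x0; have xn0 : x != 0 by rewrite gt_eqF.
  apply: (is_derive_eq (@dfunV _ (fun y => 1 - E y) x _ (E1 _ x0) (dfunD (dfun_cst 1 _) (dfunN (dE _ x0))))).
  by rewrite /D; field; rewrite E1.
- move=> x /= x0; have xn0 : x != 0 by rewrite gt_eqF.
  have Dn0 : D x != 0 by rewrite mulf_neq0// expf_neq0// E1.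
  apply: (is_derive_eq (dfunM (dE _ x0) (dfunV Dn0 (dD _ x0)))).
  by rewrite /D; field; rewrite E1.
- move=> x /= x0.
  have E1p : 0 < 1 - E x by rewrite subr_gt0 expR_lt1 oppr_lt0 invr_gt0.
  apply: mulr_ge0; last by rewrite invr_ge0 mulr_ge0// exprn_ge0// ltW.
  rewrite mulr_ge0 ?expR_ge0// subr_ge0 tanh_le// invr_ge0 ltW//.
Qed.

Lemma S_P_sub_S_F : @S_P R `<=` @S_F R.
Proof.
apply: (@skew_class_sub R _ _ phi (@F_Frechet_nd R) (@F_Pareto_nd R)).
- move=> x; rewrite F_Frechet01 => x0.
  have E1p : 0 < 1 - expR (- x^-1) by rewrite subr_gt0 expR_lt1 oppr_lt0 invr_gt0.
  rewrite /F_Pareto /F_Frechet x0 /phi invf_ge1// gerBl expR_ge0 invrK; lra.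
- have -> : [set x : R | 0 < F_Frechet x < 1] = [set x | 0 < x].
    by apply/funext => x; rewrite /= F_Frechet01.
  exact: frechet_pareto_convex.
Qed.

End frechet_pareto.

(** * The Cauchy-Fréchet transfer map: trigonometric and logarithmic bounds *)

Section cauchy_frechet.
Context {R : realType}.
Implicit Types (u v w x : R).

(** Drives a chain of Taylor-type bounds, in which the derivative of a difference is nonnegative by
    an elementary fact or an earlier bound. *)
Let nonneg_derive (f f' : R -> R) : f 0 = 0 ->
  (forall x, is_derive x 1 f (f' x)) ->
  (forall x, 0 <= x <= pi / 2 -> 0 <= f' x) ->
  forall x, 0 <= x <= pi / 2 -> 0 <= f x.
Proof.
move=> f0 df f'0 x Ix; rewrite -[leLHS]f0.
apply: (@derive_nd R [set x | 0 <= x <= pi / 2] f f') => //=.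
- move=> a b /andP[a0 _] /andP[_ b1] z /andP[/(le_trans a0) z0 /le_trans zb] /=.
  by rewrite z0 zb.
- by rewrite lexx divr_ge0// pi_ge0.
- by case/andP: Ix.
Qed.

Let sin_I0 x : 0 <= x <= pi / 2 -> 0 <= sin x.
Proof.
move=> /andP[x0 x1]; apply: sin_ge0_pi; rewrite x0 (le_trans x1)//.
by rewrite ler_pdivrMr// ler_peMr ?pi_ge0//; lra.
Qed.

Lemma sin_le_id x : 0 <= x <= pi / 2 -> sin x <= x.
Proof.
move=> Ix; rewrite -subr_ge0; move: x Ix.
apply: (@nonneg_derive (fun x => x - sin x) (fun x => 1 - cos x)).
- by rewrite sin0 subr0.
- by move=> x _; rewrite subr_ge0 cos_le1.
Qed.

Lemma cos_ge_quad x : 0 <= x <= pi / 2 -> 1 - x ^+ 2 / 2 <= cos x.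
Proof.
move=> Ix; rewrite -subr_ge0; move: x Ix.
apply: (@nonneg_derive (fun x => cos x - (1 - x ^+ 2 / 2)) (fun x => x - sin x)).
- by rewrite cos0; lra.
- move=> x /=; apply: (is_derive_eq (dfunD (dfun_cos (dfun_id x)) (dfunN (dfunD (dfun_cst 1 _)
    (dfunN (dfunM (dfunX 2 (dfun_id x)) (dfun_cst (2^-1) _))))))).
  by rewrite /=; field.
- by move=> x Ix; rewrite subr_ge0 sin_le_id.
Qed.

Lemma idMcos_le_sin x : 0 <= x <= pi / 2 -> x * cos x <= sin x.
Proof.
move=> Ix; rewrite -subr_ge0; move: x Ix.
apply: (@nonneg_derive (fun x => sin x - x * cos x) (fun x => x * sin x)).
- by rewrite sin0; lra.
- move=> x /=; apply: (is_derive_eq (dfunD (dfun_sin (dfun_id x)) (dfunN (dfunM (dfun_id x)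
    (dfun_cos (dfun_id x)))))).
  by rewrite /=; ring.
- by move=> x Ix; rewrite mulr_ge0 ?sin_I0//; case/andP: Ix.
Qed.

(** The second order bound on [x * cot x] at [0], cleared of its denominator. *)
Lemma idMcos_le_quad x : 0 <= x <= pi / 2 ->
  x * cos x <= (1 - x ^+ 2 / 3) * sin x.
Proof.
move=> Ix; rewrite -subr_ge0; move: x Ix.
apply: (@nonneg_derive (fun x => (1 - x ^+ 2 / 3) * sin x - x * cos x)
  (fun x => x / 3 * (sin x - x * cos x))).
- by rewrite sin0; lra.
- move=> x /=; apply: (is_derive_eq (dfunD (dfunM (dfunD (dfun_cst 1 _)
    (dfunN (dfunM (dfunX 2 (dfun_id x)) (dfun_cst (3^-1) _)))) (dfun_sin (dfun_id x)))
    (dfunN (dfunM (dfun_id x) (dfun_cos (dfun_id x)))))).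
  by rewrite /=; field.
- move=> x Ix; rewrite mulr_ge0 ?subr_ge0 ?idMcos_le_sin//.
  by rewrite divr_ge0//; case/andP: Ix.
Qed.

(** This is [y <= sinh y] for [y = - ln u]. The derivative of the difference is a square over
    [2 * u ^+ 2]. *)
Lemma Nln_le u : 0 < u <= 1 -> - ln u <= (u^-1 - u) / 2.
Proof.
move=> /andP[u0 u1]; rewrite -subr_ge0 opprK.
pose f u : R := - ((u^-1 - u) * 2^-1 + ln u).
have f1 : f 1 = 0 by rewrite /f ln1; field.
suff : f u <= f 1 by rewrite f1 /f; lra.
apply: (@derive_nd R [set x | 0 < x] f (fun u => (u - 1) ^+ 2 / (2 * u ^+ 2))) => //=.
- exact: ray_is_interval.
- move=> x /= x0; have xn0 : x != 0 by rewrite gt_eqF.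
  apply: (is_derive_eq (dfunN (dfunD (dfunM (dfunD (dfunV xn0 (dfun_id x))
     (dfunN (dfun_id x))) (dfun_cst (2^-1) _)) (dfun_ln x0 (dfun_id x))))).
  by field.
- by move=> x x0; rewrite divr_ge0 ?sqr_ge0// mulr_ge0// sqr_ge0.
Qed.

(** Through [pi < 4] and [ln 4 = 2 * ln 2 <= 2]. *)
Lemma ln_pi_le2 : ln pi <= 2 :> R.
Proof.
have : ln (2 * 2) = ln (1 + 1) *+ 2 :> R.
  by rewrite lnM ?posrE// mulr2n; congr (ln _ + ln _); lra.
have := @le_ln1Dx R 1 ltac:(lra).
have : ln pi <= ln (2 * 2) :> R.
  rewrite ler_ln ?posrE ?pi_gt0 ?mulr_gt0//.
  by have := @pihalf_lt2 R; rewrite ltr_pdivrMr//; lra.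
rewrite mulr2n; lra.
Qed.

(* Tight as [v --> pi], where [cos x / sin x] needs its second order bound; for
   [v <= 1] the first summand suffices, for [1 <= v <= pi / 2] the second. *)
Lemma cot_ln_ge v : 0 < v < pi ->
  2^-1 <= v * cos v / sin v - (ln (v / pi))^-1.
Proof.
move=> /andP[v0 vpi]; have pi0 := @pi_gt0 R.
have pi2 := @pi_ge2 R.
have lnlt0 : ln (v / pi) < 0.
  by apply: ln_lt0; rewrite divr_gt0//= ltr_pdivrMr// mul1r.
have sv : 0 < sin v by apply: sin_gt0_pi; rewrite v0.
have [v1|v1] := leP v 1.
  have Iv : 0 <= v <= pi / 2 by rewrite ltW//= ler_pdivlMr//; lra.
  (* Since [sin v <= v], the quotient [v * cos v / sin v] is at least [cos v]. *)
  have cv : 2^-1 <= cos v by apply: le_trans (cos_ge_quad Iv); nra.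
  suff : 2^-1 <= v * cos v / sin v.
    by move=> h; rewrite (le_trans h)// lerDl oppr_ge0 invr_le0 ltW.
  rewrite ler_pdivlMr//; have := sin_le_id Iv; nra.
have [v2|v2] := leP v (pi / 2).
  have cv : 0 <= cos v by apply: cos_ge0_pihalf; rewrite v2 andbT; lra.
  suff : 2^-1 <= - (ln (v / pi))^-1.
    move=> h; rewrite (le_trans h)// lerDr.
    by apply: mulr_ge0; [nra|rewrite invr_ge0 ltW].
  (* Here [- ln (v / pi) = ln pi - ln v <= ln pi <= 2], as [v >= 1]. *)
  rewrite -invrN lef_pV2 ?posrE ?oppr_gt0//.
  rewrite ln_div ?posrE// opprB lerBlDr.
  by rewrite (le_trans ln_pi_le2)// lerDl ln_ge0// ltW.
(* Reflection: [w] is small when [v] is near [pi], so the bounds near the origin apply to it; [r]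
   and [d] are [v] and [w] in units of [pi]. *)
pose w := pi - v; pose r := v / pi; pose d := 1 - r.
have w0 : 0 < w by rewrite subr_gt0.
have Iw : 0 <= w <= pi / 2 by rewrite ltW//= /w; lra.
have sw : sin w = sin v by rewrite /w sinB sinpi cospi; lra.
have cw : cos w = - cos v by rewrite /w cosB sinpi cospi; lra.
have r1 : r < 1 by rewrite ltr_pdivrMr// mul1r.
have r0 : 2^-1 < r by rewrite ltr_pdivlMr//; lra.
have vE : v = pi * r by rewrite /r mulrC divfK// gt_eqF.
have wE : w = pi * d by rewrite /w vE /d; ring.
have h1 : - ln r <= (r^-1 - r) / 2 by apply: Nln_le; lra.
have h2 := idMcos_le_quad Iw; rewrite sw cw in h2.
have h1' : 2 * r / (1 - r ^+ 2) <= - (ln r)^-1.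
  have -> : 2 * r / (1 - r ^+ 2) = ((r^-1 - r) / 2)^-1.
    by field; do ! (apply/andP; split); nra.
  rewrite -invrN lef_pV2// posrE ?oppr_gt0//.
  by apply: lt_le_trans h1; rewrite oppr_gt0.
have h2' : - (r / d * (1 - 4 * d ^+ 2 / 3)) <= v * cos v / sin v.
  have -> : v * cos v / sin v = - (r / d * ((w * - cos v) / sin v)).
    by rewrite wE vE; field; rewrite -vE !gt_eqF// subr_gt0.
  rewrite lerN2 ler_wpM2l//; first by rewrite divr_ge0 /d; lra.
  rewrite ler_pdivrMr// (le_trans h2)// ler_wpM2r ?(ltW sv)//.
  (* The coefficient [4] comes from [pi ^+ 2 >= 4], since [w = pi * d]. *)
  have : 2 ^+ 2 <= pi ^+ 2 :> R by rewrite ler_pXn2r// ?nnegrE; lra.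
  by move=> /(ler_wpM2r (sqr_ge0 d)); rewrite wE exprMn; lra.
apply: le_trans (lerD h2' h1'); rewrite -subr_ge0.
(* The poles at [d = 0] cancel and leave a multiple of [d], in which [8 * r * (1 + r) - 3] is
   positive because [r > 1 / 2]. *)
have -> : - (r / d * (1 - 4 * d ^+ 2 / 3)) + 2 * r / (1 - r ^+ 2) - 2^-1 =
   (8 * r * (1 + r) - 3) * d / (6 * (1 + r)).
  by rewrite /d; field; do ! (apply/andP; split); nra.
by apply: divr_ge0; rewrite /d; nra.
Qed.

(** This is [cot_ln_ge] at [v = atan x + pi / 2], where [F_Cauchy x = v / pi] and [cot v = - x]. *)
Lemma F_Cauchy_cot_ln x :
  2^-1 <= - (pi * x * F_Cauchy x) - (ln (F_Cauchy x))^-1.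
Proof.
have pi0 := @pi_gt0 R.
pose v := atan x + pi / 2.
have pin0 : pi != 0 :> R by rewrite gt_eqF.
have uE : F_Cauchy x = v / pi.
  by rewrite /F_Cauchy /v mulrDl [pi / 2 / pi]mulrAC divff// mul1r mulrC.
have cx : 0 < cos (atan x) by apply: cos_gt0_pihalf; rewrite atan_gtNpi2 atan_ltpi2.
have := @cot_ln_ge v; rewrite {1 2}/v -uE.
have -> : v * cos v / sin v = - (pi * x * F_Cauchy x).
  (* Stated over free variables to keep [pi] and the trigonometric functions out of [field]. *)
  have tE (p a s c : R) : p != 0 -> c != 0 ->
      a * - s / c = - (p * (s / c) * (a / p)).
    by move=> p0 c0; field; rewrite p0 c0.
  rewrite {2 3}/v sinDpihalf cosDpihalf (tE pi)// ?gt_eqF//.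
  by rewrite -[sin _ / cos _]/(tan _) atanK uE.
apply; have := atan_gtNpi2 x; have := atan_ltpi2 x.
by rewrite /v => h1 h2; apply/andP; split; lra.
Qed.

(* [F_F^-1 \o F_C] *)
Let phi x : R := - (ln (F_Cauchy x))^-1.

(** The first derivative is [1 / D] with [D = q * u * ln u ^+ 2]. In [- D' / D ^+ 2] the only factor
    of unclear sign is the one bounded by [F_Cauchy_cot_ln]. *)
Lemma cauchy_frechet_convex : convex_on [set: R] phi.
Proof.
pose u := @F_Cauchy R.
(* [field] would unfold [pi]. *)
have [p pE] : exists p : R, p = pi by exists pi.
pose q x : R := p * (1 + x ^+ 2).
have p0 : 0 < p by rewrite pE pi_gt0.
have pn0 : p != 0 by rewrite gt_eqF.
have q0 x : 0 < q x by rewrite mulr_gt0// ltr_wpDr ?sqr_ge0.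
have qn0 x : q x != 0 by rewrite gt_eqF.
have x1n0 x : 1 + x ^+ 2 != 0 :> R by rewrite gt_eqF// ltr_wpDr ?sqr_ge0.
have u0 x : 0 < u x by case/andP: (F_Cauchy01 x).
have un0 x : u x != 0 by rewrite gt_eqF.
have l0 x : ln (u x) < 0 by apply/ln_lt0/F_Cauchy01.
have ln0 x : ln (u x) != 0 by rewrite lt_eqF.
have du x : is_derive x 1 u (q x)^-1.
  apply: (is_derive_eq (dfunD (dfunM (dfun_cst (pi^-1) _) (dfun_atan (dfun_id x)))
    (dfun_cst (2^-1) _))).
  by rewrite -pE /q; field; rewrite pn0 x1n0.
have dl x : is_derive x 1 (fun y => ln (u y)) ((u x)^-1 * (q x)^-1).
  exact: dfun_ln.
have dq x : is_derive x 1 q (p * (2 * x)).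
  apply: (is_derive_eq (dfunM (dfun_cst p _) (dfunD (dfun_cst 1 _) (dfunX 2 (dfun_id x))))).
  by rewrite /=; ring.
pose D x := q x * (u x * ln (u x) ^+ 2).
have Dn0 x : D x != 0 by rewrite !mulf_neq0// expf_neq0.
have dD x : is_derive x 1 D (p * (2 * x) * u x * ln (u x) ^+ 2 +
    ln (u x) ^+ 2 + 2 * ln (u x)).
  apply: (is_derive_eq (dfunM (dq x) (dfunM (du x) (dfunX 2 (dl x))))).
  by field; rewrite qn0 un0.
apply: (@derive2_convex R _ phi (fun x => (D x)^-1)
  (fun x => 2 * ln (u x) ^+ 2 * (- (p * x * u x) - (ln (u x))^-1 - 2^-1) / D x ^+ 2)).
- by [].
- move=> x _; apply: (is_derive_eq (dfunN (@dfunV _ (fun y => ln (u y)) x _ (ln0 x) (dl x)))).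
  by rewrite /D; field; rewrite qn0 un0 ln0.
- move=> x _; apply: (is_derive_eq (@dfunV _ D x _ (Dn0 x) (dD x))).
  by field; rewrite Dn0 ln0.
- move=> x _; apply: mulr_ge0; last by rewrite invr_ge0 sqr_ge0.
  apply: mulr_ge0; first by rewrite mulr_ge0// sqr_ge0.
  by rewrite subr_ge0 pE F_Cauchy_cot_ln.
Qed.

Lemma S_F_sub_S_C : @S_F R `<=` @S_C R.
Proof.
apply: (@skew_class_sub R _ _ phi (@F_Cauchy_nd R) (@F_Frechet_nd R)).
- move=> x /[dup] ux /ln_lt0 lnx; case/andP: ux => ux _.
  by rewrite /F_Frechet /phi oppr_gt0 invr_lt0 lnx invrN invrK opprK lnK.
- by move=> x y t _ _; exact: cauchy_frechet_convex.
Qed.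

End cauchy_frechet.

(** * The Cauchy distribution and its stability *)

Section ftc_line.
Context {R : realType}.
Notation mu := (@lebesgue_measure R).
Implicit Types (f F : R -> R) (t l : R).

Lemma ge0_FTCy f F t l : (forall x, 0 <= f x) -> continuous f ->
  (forall x : R, is_derive x 1 F (f x)) -> F x @[x --> +oo] --> l ->
  (\int[mu]_(x in `[t, +oo[) (f x)%:E = (l - F t)%:E)%E.
Proof.
move=> f0 cf dF Fl.
have cF : continuous F by move=> x; exact: dfun_continuous (dF x).
rewrite (@ge0_continuous_FTC2y R f F t l)//.
- exact: continuous_subspaceT.
- exact/cvg_at_right_filter/cF.
- by move=> x _; rewrite derive1E; have [] := dF x.
Qed.

(** Reflection reduces this to [ge0_FTCy] with antiderivative [- F (- x)]. *)
Lemma ge0_FTCNy f F t l : (forall x, 0 <= f x) -> continuous f ->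
  (forall x : R, is_derive x 1 F (f x)) -> F x @[x --> -oo] --> l ->
  (\int[mu]_(x in `]-oo, t]) (f x)%:E = (F t - l)%:E)%E.
Proof.
move=> f0 cf dF Fl.
rewrite -[in LHS](opprK t) ge0_integration_by_substitutionNy; last 2 first.
- exact: continuous_subspaceT.
- by move=> x _; exact: f0.
have f0' x : 0 <= (f \o -%R) x by exact: f0.
have cf' : continuous (f \o -%R).
  by move=> x; apply: continuous_comp; [exact: oppr_continuous|exact: cf].
have dF' (x : R) : is_derive x 1 (fun x : R => - F (- x)) ((f \o -%R) x).
  apply: (is_derive_eq (dfunN (is_derive1_comp (dF (- x)) (dfunN (dfun_id x))))).
  by rewrite mulrN1 opprK.
have Fl' : - F (- x) @[x --> +oo] --> - l by apply: cvgN; apply/cvgNy_compNP.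
by rewrite (ge0_FTCy _ f0' cf' dF' Fl') !opprK addrC.
Qed.

Lemma ge0_FTC_line f F l l' : (forall x, 0 <= f x) -> continuous f ->
  (forall x : R, is_derive x 1 F (f x)) ->
  F x @[x --> -oo] --> l -> F x @[x --> +oo] --> l' ->
  (\int[mu]_x (f x)%:E = (l' - l)%:E)%E.
Proof.
move=> f0 cf dF Fl Fl'.
have mf : measurable_fun [set: R] (fun x => (f x)%:E).
  by apply/measurable_EFinP; exact: continuous_measurable_fun.
rewrite -(setUv `]-oo, (0:R)]%classic) ge0_integral_setU//=; last 4 first.
- exact: measurableC.
- by rewrite setUv.
- by move=> x _; rewrite lee_fin.
- exact/disj_setPCl.
rewrite setCitvl integral_itv_obnd_cbnd; last first.
  by apply: measurable_funTS.
rewrite (ge0_FTCNy _ f0 cf dF Fl) (ge0_FTCy _ f0 cf dF Fl') -EFinD; congr EFin; ring.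
Qed.

End ftc_line.

Section cauchy_pdf.
Context {R : realType}.
Notation mu := (@lebesgue_measure R).
Implicit Types (x t : R).

Definition cauchy_pdf x : R := pi^-1 * (1 + x ^+ 2)^-1.

Lemma oneDsqr_gt0 x : 0 < 1 + x ^+ 2.
Proof. by rewrite ltr_wpDr// sqr_ge0. Qed.

Lemma cauchy_pdf_ge0 x : 0 <= cauchy_pdf x.
Proof. by rewrite mulr_ge0// invr_ge0 ?pi_ge0// ltW// oneDsqr_gt0. Qed.

Lemma cauchy_pdf_le x : cauchy_pdf x <= pi^-1.
Proof.
rewrite ler_piMr// ?invr_ge0 ?pi_ge0// invf_le1 ?oneDsqr_gt0// lerDl.
exact: sqr_ge0.
Qed.

Lemma continuous_cauchy_pdf : continuous cauchy_pdf.
Proof.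
move=> x; have x0 := lt0r_neq0 (oneDsqr_gt0 x).
exact: dfun_continuous (dfunM (dfun_cst (pi^-1 : R) x)
  (@dfunV _ (fun y => 1 + y ^+ 2) x _ x0
    (dfunD (dfun_cst 1 x) (dfunX 2 (dfun_id x))))).
Qed.

Lemma measurable_cauchy_pdf : measurable_fun [set: R] cauchy_pdf.
Proof. exact: continuous_measurable_fun continuous_cauchy_pdf. Qed.

Lemma derive_F_Cauchy x : is_derive x (1 : R) (@F_Cauchy R) (cauchy_pdf x).
Proof.
apply: (is_derive_eq (dfunD (dfunM (dfun_cst (pi^-1) _) (dfun_atan (dfun_id x)))
    (dfun_cst (2^-1) _))).
by rewrite mulr1 mulr0 !addr0.
Qed.

Lemma cvgNy_atan : atan x @[x --> -oo] --> (- (pi / 2) : R).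
Proof.
apply/cvgNy_compNP.
rewrite (_ : atan \o -%R = (fun x : R => - atan x)).
  by apply: cvgN; exact: cvgy_atan.
by apply/funext => x /=; rewrite atanN.
Qed.

Let pi_half : pi^-1 * (pi / 2) = 2^-1 :> R.
Proof. by rewrite mulKf// gt_eqF// pi_gt0. Qed.

Lemma cvgy_F_Cauchy : F_Cauchy x @[x --> +oo] --> (1 : R).
Proof.
rewrite (_ : 1 = pi^-1 * (pi / 2) + 2^-1 :> R); last by rewrite pi_half; lra.
by apply: cvgD; [apply: cvgMr; exact: cvgy_atan|exact: cvg_cst].
Qed.

Lemma cvgNy_F_Cauchy : F_Cauchy x @[x --> -oo] --> (0 : R).
Proof.
rewrite (_ : 0 = pi^-1 * (- (pi / 2)) + 2^-1 :> R); last by rewrite mulrN pi_half; lra.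
by apply: cvgD; [apply: cvgMr; exact: cvgNy_atan|exact: cvg_cst].
Qed.

Lemma integral_cauchy_pdf : (\int[mu]_x (cauchy_pdf x)%:E = 1)%E.
Proof.
rewrite (ge0_FTC_line cauchy_pdf_ge0 continuous_cauchy_pdf derive_F_Cauchy
  cvgNy_F_Cauchy cvgy_F_Cauchy).
by rewrite subr0.
Qed.

Lemma integralNy_cauchy_pdf t :
  (\int[mu]_(x in `]-oo, t]) (cauchy_pdf x)%:E = (F_Cauchy t)%:E)%E.
Proof.
rewrite (ge0_FTCNy _ cauchy_pdf_ge0 continuous_cauchy_pdf derive_F_Cauchy
  cvgNy_F_Cauchy).
by rewrite subr0.
Qed.

End cauchy_pdf.

Section cauchy_prob.
Context {R : realType}.
Local Open Scope ereal_scope.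
Notation mu := (@lebesgue_measure R).

Definition cauchy_prob (A : set (measurableTypeR R)) : \bar R :=
  \int[mu]_(x in A) (cauchy_pdf x)%:E.

Let cauchy0 : cauchy_prob set0 = 0.
Proof. by rewrite /cauchy_prob integral_set0. Qed.

Let cauchy_ge0 A : 0 <= cauchy_prob A.
Proof. by apply: integral_ge0 => x _; rewrite lee_fin cauchy_pdf_ge0. Qed.

Let cauchy_sigma_additive : semi_sigma_additive cauchy_prob.
Proof.
move=> /= F mF tF mUF; rewrite /cauchy_prob; apply: cvg_toP.
  apply: ereal_nondecreasing_is_cvgn => m n mn.
  apply: lee_sum_nneg_natr => // k _ _; apply: integral_ge0 => /= x Fkx.
  by rewrite lee_fin cauchy_pdf_ge0.
rewrite ge0_integral_bigcup//=.
- apply/measurable_funTS/measurableT_comp => //.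
  exact: measurable_cauchy_pdf.
- by move=> x _; rewrite lee_fin cauchy_pdf_ge0.
Qed.

HB.instance Definition _ := isMeasure.Build _ _ _
  cauchy_prob cauchy0 cauchy_ge0 cauchy_sigma_additive.

Let cauchy_setT : cauchy_prob [set: R] = 1.
Proof. exact: integral_cauchy_pdf. Qed.

HB.instance Definition _ :=
  @Measure_isProbability.Build _ _ R cauchy_prob cauchy_setT.

(** The density is at most [pi^-1], so Lebesgue-null sets stay null. *)
Lemma cauchy_prob_dominates : cauchy_prob `<< mu.
Proof.
apply/null_content_dominatesP => A mA muA0.
apply/eqP; rewrite eq_le cauchy_ge0 andbT.
apply: (@le_trans _ _ (\int[mu]_(x in A) (pi^-1)%:E)); last first.
  by rewrite integral_cst//= muA0 mule0.
apply: ge0_le_integral => //=.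
- by move=> x _; rewrite lee_fin cauchy_pdf_ge0.
- apply/measurable_funTS/measurableT_comp => //=.
  exact: measurable_cauchy_pdf.
- by move=> x _; rewrite lee_fin cauchy_pdf_le.
Qed.

(** Radon-Nikodym change of variables, after which the abstract derivative is identified almost
    everywhere with [cauchy_pdf]. *)
Lemma integral_cauchy_prob (f : R -> \bar R) : measurable_fun setT f ->
  \int[cauchy_prob]_x `|f x| < +oo ->
  \int[cauchy_prob]_x f x = \int[mu]_x (f x * (cauchy_pdf x)%:E).
Proof.
move=> mf finf.
rewrite -(Radon_Nikodym_change_of_variables cauchy_prob_dominates)//=; last first.
  by apply/integrableP; split.
apply: ae_eq_integral => //.
- apply: emeasurable_funM => //; apply: (measurable_int mu).
  by apply: Radon_Nikodym_integrable; exact: cauchy_prob_dominates.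
- apply: emeasurable_funM => //=; apply/measurableT_comp => //=.
  exact: measurable_cauchy_pdf.
- apply: ae_eqe_mul2l => /=.
  rewrite Radon_NikodymE//=; first exact: cauchy_prob_dominates.
  move=> ?.
  case: cid => /= h [h1 h2 h3].
  apply: integral_ae_eq => //=.
  + by apply/measurableT_comp =>//; exact: measurable_cauchy_pdf.
  + by move=> E _ mE; rewrite -h3.
Qed.

End cauchy_prob.

(** * Convolution of two scaled Cauchy laws *)

Section cauchy_convolution.
Context {R : realType}.
Notation mu := (@lebesgue_measure R).
Variables a b : R.
Hypotheses (a0 : 0 < a) (b0 : 0 < b) (ab1 : a + b = 1).
Implicit Types (x c t : R).

(** [Q c x / b ^+ 2] is the denominator [1 + y ^+ 2] of the density at [y = (c - a * x) / b]. *)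
Let Q c x := b ^+ 2 + (c - a * x) ^+ 2.

Let Q_gt0 c x : 0 < Q c x.
Proof. by rewrite ltr_pwDl ?sqr_ge0// exprn_gt0. Qed.

(** Each logarithm diverges but the difference does not: the quotient inside is [h x^-1] with [h]
    continuous at [0] and [h 0 = a ^- 2]. *)
Let ratio_cvgy c : ln (1 + x ^+ 2) - ln (Q c x) @[x --> +oo] --> ln (a ^- 2).
Proof.
pose h y := (y ^+ 2 + 1) / ((b * y) ^+ 2 + (c * y - a) ^+ 2).
have d0 : (b * 0) ^+ 2 + (c * 0 - a) ^+ 2 != 0.
  by rewrite !mulr0 expr0n/= !add0r sqrrN expf_neq0// gt_eqF.
have h0 : h 0 = a ^- 2.
  by rewrite /h !mulr0 !expr0n/= !add0r sqrrN mul1r.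
have ch : {for 0, continuous h}.
  have dl k := dfunM (dfun_cst k (0:R)) (dfun_id 0).
  have dden := dfunD (dfunX 2 (dl b)) (dfunX 2 (dfunD (dl c) (dfun_cst (- a) 0))).
  exact: dfun_continuous (dfunM (dfunD (dfunX 2 (dfun_id 0)) (dfun_cst (1:R) 0))
    (@dfunV _ (fun y => (b * y) ^+ 2 + (c * y - a) ^+ 2) 0 _ d0 dden)).
have V0 : x^-1 @[x --> +oo] --> (0 : R).
  apply/(@gtr0_cvgV0 R R +oo _ (fun x => x)); last exact: cvg_id.
  exact: (nbhs_pinfty_gt (num_real 0)).
have : ln (h x^-1) @[x --> +oo] --> ln (a ^- 2).
  rewrite -h0; apply: (@cvg_comp _ _ _ (fun x : R => x^-1) (fun y => ln (h y)) _ _ _ V0).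
  apply: continuous_comp => //; apply: continuous_ln.
  by rewrite h0 invr_gt0 exprn_gt0.
apply: cvg_trans; apply: near_eq_cvg; near=> x.
have x0 : 0 < x by near: x; exact: (nbhs_pinfty_gt (num_real 0)).
rewrite -ln_div ?posrE ?oneDsqr_gt0//; congr ln.
rewrite /h /Q; field.
by apply/andP; split; [exact: (lt0r_neq0 (Q_gt0 c x))|rewrite gt_eqF].
Unshelve. all: end_near. Qed.

Let ratio_cvgNy c : ln (1 + x ^+ 2) - ln (Q c x) @[x --> -oo] --> ln (a ^- 2).
Proof.
apply/cvgNy_compNP; apply: cvg_trans (ratio_cvgy (- c)).
apply: near_eq_cvg; near=> x => /=; congr (ln _ - ln _); rewrite /Q; ring.
Unshelve. all: end_near. Qed.

Let shift_cvgy c : (a * x - c) / b @[x --> +oo] --> +oo.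
Proof.
apply: gt0_cvgMly; first by rewrite invr_gt0.
by apply: cvg_comp (cvg_addrr (- c)); apply: gt0_cvgMry.
Qed.

Let shift_cvgNy c : (a * x - c) / b @[x --> -oo] --> -oo.
Proof.
apply: gt0_cvgMlNy; first by rewrite invr_gt0.
by apply: cvg_comp (cvg_addrr_Ny (- c)); apply: gt0_cvgMrNy.
Qed.

(* For [c = 0] and [a = b] the integrand has double poles and the partial
   fractions below degenerate; excluding [c = 0] is harmless under an integral
   over [c]. *)
Lemma cauchy_pdf_convolution c : c != 0 ->
  (\int[mu]_x (cauchy_pdf x * (b^-1 * cauchy_pdf ((c - a * x) / b)))%:E =
   (cauchy_pdf c)%:E)%E.
Proof.
move=> c0.
(* [((1 + x ^+ 2) * Q c x)^-1] is the sum of [(al * x + be) / (1 + x ^+ 2)] and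
   [(- a * al * (a * x - c) + de) / Q c x]. *)
pose N := (1 + c ^+ 2) * (c ^+ 2 + (a - b) ^+ 2).
pose al := 2 * a * c / N.
pose be := (c ^+ 2 + b - a) / N.
pose de := a ^+ 2 * (c ^+ 2 + a - b) / N.
have c2 : c ^+ 2 + (a - b) ^+ 2 != 0.
  by rewrite gt_eqF// ltr_pwDl ?sqr_ge0// exprn_even_gt0.
have [p pE] : exists p : R, p = pi by exists pi.
have pn0 : p != 0 by rewrite pE gt_eqF// pi_gt0.
(* The antiderivative given by these partial fractions. The factor [b] is [b^-1] times the [b ^+ 2]
   by which [Q] differs from the density's denominator. *)
pose Phi x := p ^- 2 * b * (al / 2 * (ln (1 + x ^+ 2) - ln (Q c x)) +
   (be * atan x + de / (a * b) * atan ((a * x - c) / b))).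
pose f x := cauchy_pdf x * (b^-1 * cauchy_pdf ((c - a * x) / b)).
have f0 x : 0 <= f x.
  apply: mulr_ge0; first exact: cauchy_pdf_ge0.
  by apply: mulr_ge0; [rewrite invr_ge0 ltW|exact: cauchy_pdf_ge0].
have cf : continuous f.
  move=> x.
  have dl := dfunM (dfunD (dfun_cst c x) (dfunN (dfunM (dfun_cst a x) (dfun_id x))))
    (dfun_cst (b^-1) x).
  apply: continuousM; first exact: continuous_cauchy_pdf.
  apply: continuousM; first exact: cst_continuous.
  apply: continuous_comp; first exact: dfun_continuous dl.
  exact: continuous_cauchy_pdf.
have an0 : a != 0 by rewrite gt_eqF.
have bn0 : b != 0 by rewrite gt_eqF.
have bE : b = 1 - a by rewrite -ab1 [a + b]addrC addrK.
have dPhi (x : R) : is_derive x 1 Phi (f x).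
  have dl := dfunM (dfun_cst a x) (dfun_id x).
  have dQ := dfunD (dfun_cst (b ^+ 2) x) (dfunX 2 (dfunD (dfun_cst c x) (dfunN dl))).
  have dQ1 := dfunD (dfun_cst 1 x) (dfunX 2 (dfun_id x)).
  apply: (is_derive_eq (dfunM (dfun_cst (p ^- 2 * b) x) (dfunD
    (dfunM (dfun_cst (al / 2) x) (dfunD (@dfun_ln _ (fun x => 1 + x ^+ 2) x _ (oneDsqr_gt0 x) dQ1)
      (dfunN (@dfun_ln _ (Q c) x _ (Q_gt0 c x) dQ))))
    (dfunD (dfunM (dfun_cst be x) (dfun_atan (dfun_id x)))
      (dfunM (dfun_cst (de / (a * b)) x)
        (dfun_atan (dfunM (dfunD dl (dfun_cst (- c) x)) (dfun_cst (b^-1) x)))))))).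
  have Qn0 := lt0r_neq0 (Q_gt0 c x); have xn0 := lt0r_neq0 (oneDsqr_gt0 x).
  have c1n0 := lt0r_neq0 (oneDsqr_gt0 c).
  rewrite /f /cauchy_pdf -pE /al /be /de /N.
  move: c2 Qn0 bn0; rewrite /Q bE /= => c2 Qn0 bn0.
  by field; rewrite bn0 Qn0 pn0 xn0 an0 c2 c1n0.
have yl : Phi x @[x --> +oo] --> p ^- 2 * b * (al / 2 * ln (a ^- 2) +
   (be * (pi / 2) + de / (a * b) * (pi / 2))).
  apply: cvgMr; apply: cvgD; first exact: cvgMr.
  apply: cvgD; apply: cvgMr; first exact: cvgy_atan.
  apply: (@cvg_comp _ _ _ (fun x => (a * x - c) / b) atan); first exact: shift_cvgy.
  exact: cvgy_atan.
have Nyl : Phi x @[x --> -oo] --> p ^- 2 * b * (al / 2 * ln (a ^- 2) +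
   (be * - (pi / 2) + de / (a * b) * - (pi / 2))).
  apply: cvgMr; apply: cvgD; first exact: cvgMr.
  apply: cvgD; apply: cvgMr; first exact: cvgNy_atan.
  apply: (@cvg_comp _ _ _ (fun x => (a * x - c) / b) atan); first exact: shift_cvgNy.
  exact: cvgNy_atan.
(* The logarithmic terms have the same limit at both ends and drop out; with [a + b = 1] the jumps
   of the arctangents add up to the density at [c]. *)
rewrite (ge0_FTC_line f0 cf dPhi Nyl yl) -pE /cauchy_pdf -pE; congr EFin.
rewrite /al /be /de /N; move: c2; rewrite bE => c2.
by field; rewrite (lt0r_neq0 (oneDsqr_gt0 c)) pn0 -bE bn0 an0 bE c2.
Qed.

(** The density at [c] of [a * x + b * C'], with [C'] Cauchy and [x] fixed. *)
Let k c x := b^-1 * cauchy_pdf ((c - a * x) / b).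

Let k_ge0 c x : 0 <= k c x.
Proof. by apply: mulr_ge0; [rewrite invr_ge0 ltW|exact: cauchy_pdf_ge0]. Qed.

Let integral_k x t :
  (\int[mu]_(c in `]-oo, t]) (k c x)%:E = (F_Cauchy ((t - a * x) / b))%:E)%E.
Proof.
have dl (c : R) := dfunM (dfunD (dfun_id c) (dfun_cst (- (a * x)) c)) (dfun_cst (b^-1) c).
have ck : continuous (k^~ x).
  move=> c; apply: (@continuousM _ _ (fun=> b^-1)
    (fun c => cauchy_pdf ((c - a * x) / b))); first exact: cst_continuous.
  apply: continuous_comp; first exact: dfun_continuous (dl c).
  exact: continuous_cauchy_pdf.
have dF (c : R) : is_derive c 1 (fun c => F_Cauchy ((c - a * x) / b)) (k c x).
  apply: (is_derive_eq (is_derive1_comp (derive_F_Cauchy _) (dl c))).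
  by rewrite /k; ring.
have Fl : F_Cauchy ((c - a * x) / b) @[c --> -oo] --> (0 : R).
  apply: (@cvg_comp _ _ _ (fun c => (c - a * x) / b) (@F_Cauchy R)).
    apply: gt0_cvgMlNy; first by rewrite invr_gt0.
    exact: cvg_addrr_Ny.
  exact: cvgNy_F_Cauchy.
by rewrite (ge0_FTCNy t (k_ge0^~ x) ck dF Fl) subr0.
Qed.

Let integral_indic_itv (h : R -> R) t :
  (\int[mu]_c (h c * \1_(`]-oo, t]%classic : set R) c)%:E =
   \int[mu]_(c in `]-oo, t]) (h c)%:E)%E.
Proof.
rewrite [RHS]integral_mkcond; apply: eq_integral => c _.
by rewrite patchE indicE; case: ifPn; rewrite ?mulr1 ?mulr0.
Qed.

(** Tonelli for [cauchy_pdf x * k c x] on [c <= t]: integrating first in [c] gives the left-hand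
    side, integrating first in [x] gives the Cauchy density at [c]. *)
Lemma cauchy_cdf_convolution t :
  (\int[mu]_x (cauchy_pdf x * F_Cauchy ((t - a * x) / b))%:E =
   (F_Cauchy t)%:E)%E.
Proof.
pose D : set R := `]-oo, t]%classic.
pose g (z : measurableTypeR R * measurableTypeR R) : \bar R :=
  (cauchy_pdf z.1 * k z.2 z.1 * \1_D z.2)%:E.
have mD : measurable D by exact: measurable_itv.
pose mR := measurableTypeR R.
have m1 : measurable_fun setT (fun z : mR * mR => z.1 : R) by exact: measurable_fst.
have m2 : measurable_fun setT (fun z : mR * mR => z.2 : R) by exact: measurable_snd.
have mg : measurable_fun setT g.
  apply/measurable_EFinP; apply: measurable_funM; last first.
    by apply: (measurableT_comp _ m2); exact: measurable_indic.
  apply: measurable_funM.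
    by apply: (measurableT_comp _ m1); exact: measurable_cauchy_pdf.
  apply: measurable_funM => //.
  apply: (measurableT_comp measurable_cauchy_pdf).
  apply: measurable_funM => //; apply: measurable_funB => //.
  exact: measurable_funM.
have g0 z : (0 <= g z)%E.
  rewrite lee_fin; apply: mulr_ge0; last by rewrite indicE.
  by apply: mulr_ge0 => //; exact: cauchy_pdf_ge0.
have mk1 x : measurable_fun [set: R] (k^~ x).
  apply: measurable_funM => //; apply: (measurableT_comp measurable_cauchy_pdf).
  by apply: measurable_funM => //; apply: measurable_funB.
have mk2 c : measurable_fun [set: R] (k c).
  apply: measurable_funM => //; apply: (measurableT_comp measurable_cauchy_pdf).
  by apply: measurable_funM => //; apply: measurable_funB => //; apply: measurable_funM.
have := @fubini_tonelli _ _ _ _ R mu mu g mg g0.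
have -> : (\int[mu]_x \int[mu]_y g (x, y) =
           \int[mu]_x (cauchy_pdf x * F_Cauchy ((t - a * x) / b))%:E)%E.
  apply: eq_integral => x _; rewrite /g /= integral_indic_itv.
  under eq_integral do rewrite EFinM.
  rewrite ge0_integralZl ?lee_fin ?cauchy_pdf_ge0//.
  - by rewrite integral_k EFinM.
  - by apply/measurable_EFinP; apply: measurable_funTS; exact: mk1.
  - by move=> c _; rewrite lee_fin.
move=> ->; rewrite -integralNy_cauchy_pdf -integral_indic_itv.
apply: ae_eq_integral => //.
- exact: (@measurable_fun_fubini_tonelli_G _ _ _ _ R mu g mg g0).
- apply/measurable_EFinP; apply: measurable_funM; last exact: measurable_indic.
  exact: measurable_cauchy_pdf.
(* The inner integral is identified only for [c != 0]; the exceptional point is null. *)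
exists [set 0]; split; [exact: measurable_set1|exact: lebesgue_measure_set1|].
move=> c /= /not_implyP[_ gc]; apply: contrapT => /eqP c0; apply: gc.
rewrite /g /=; under eq_integral do rewrite EFinM.
rewrite ge0_integralZr ?lee_fin ?indicE//.
- by rewrite cauchy_pdf_convolution.
- apply/measurable_EFinP; apply: measurable_funM; last exact: mk2.
  exact: measurable_cauchy_pdf.
- by move=> x _; rewrite lee_fin; apply: mulr_ge0 => //; exact: cauchy_pdf_ge0.
Qed.

End cauchy_convolution.

(** * Sums of two independent variables *)

Section weighted_sum.
Context {R : realType}.
Variables a b : R.
Hypotheses (a0 : 0 < a) (b0 : 0 < b).
Implicit Types (t x y : R).

(** The map [f] is [id] for the variables themselves, and the transfer map when they are written as
    functions of Cauchy variables. *)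
Definition sum_le (T : Type) (f : T -> R) t : set (T * T) :=
  [set z | a * f z.1 + b * f z.2 <= t].

Lemma measurable_sum_le d (T : measurableType d) (f : T -> R) t :
  measurable_fun setT f -> measurable (sum_le f t).
Proof.
move=> mf.
have mF : measurable_fun setT (fun z : T * T => a * f z.1 + b * f z.2).
  apply: measurable_funD; apply: measurable_funM => //.
    exact: measurableT_comp.
  exact: measurableT_comp.
have := mF measurableT `]-oo, t]%classic (measurable_itv _).
by rewrite setTI.
Qed.

Lemma xsection_sum_le t x :
  xsection (sum_le (@id R) t) x = `]-oo, (t - a * x) / b]%classic.
Proof.
apply/seteqP; split => y; rewrite /xsection /= inE /sum_le /= in_itv /=.
  by rewrite ler_pdivlMr// => h; lra.
by rewrite ler_pdivlMr// => h; lra.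
Qed.

Lemma ysection_sum_le t y :
  ysection (sum_le (@id R) t) y = `]-oo, (t - b * y) / a]%classic.
Proof.
apply/seteqP; split => x; rewrite /ysection /= inE /sum_le /= in_itv /=.
  by rewrite ler_pdivlMr// => h; lra.
by rewrite ler_pdivlMr// => h; lra.
Qed.

Local Open Scope ereal_scope.

(** The factors are replaced one at a time. Sections are half-lines, on which the measures compare;
    for the first factor the product is rewritten as an integral over the second coordinate. *)
Lemma product_sum_le_homo (m0 m1 n : probability R R) t :
  (forall s, m0 `]-oo, s]%classic <= n `]-oo, s]%classic) ->
  (forall s, m1 `]-oo, s]%classic <= n `]-oo, s]%classic) ->
  (m0 \x m1) (sum_le (@id R) t) <= (n \x n) (sum_le (@id R) t).
Proof.
move=> m0n m1n; have mA := @measurable_sum_le _ R id t (@measurable_id _ _ setT).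
apply: (@le_trans _ _ ((m0 \x n) (sum_le (@id R) t))).
  apply: ge0_le_integral => //.
  - exact: measurable_fun_xsection.
  - exact: measurable_fun_xsection.
  - by move=> x _; rewrite /= xsection_sum_le.
have swap (m : probability R R) : (m \x n) (sum_le (@id R) t) =
    (m \x^ n) (sum_le (@id R) t).
  by apply: product_measure_unique => //= A B ? ?; rewrite product_measure2E.
rewrite !swap; apply: ge0_le_integral => //.
- exact: measurable_fun_ysection.
- exact: measurable_fun_ysection.
- by move=> y _; rewrite /= ysection_sum_le.
Qed.

End weighted_sum.

Section cauchy_stable.
Context {R : realType}.
Variables a b : R.
Hypotheses (a0 : 0 < a) (b0 : 0 < b) (ab1 : a + b = 1).
Local Open Scope ereal_scope.
Notation gamma := (@cauchy_prob R).

(** Conditioning on the first coordinate leads to the integral of [cauchy_cdf_convolution]. *)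
Lemma cauchy_stable t :
  (gamma \x gamma) (sum_le a b (@id (measurableTypeR R)) t) = (F_Cauchy t)%:E.
Proof.
rewrite /product_measure1.
transitivity (\int[gamma]_x (F_Cauchy ((t - a * x) / b))%:E).
  apply: eq_integral => x _ /=.
  by rewrite xsection_sum_le// /cauchy_prob integralNy_cauchy_pdf.
have mF : measurable_fun [set: R] (fun x => (F_Cauchy ((t - a * x) / b))%:E).
  apply/measurable_EFinP; apply: measurableT_comp.
    by apply: nondecreasing_measurable => //; exact: F_Cauchy_nd.
  by apply: measurable_funM => //; apply: measurable_funB => //; exact: measurable_funM.
rewrite integral_cauchy_prob//.
  by rewrite -(cauchy_cdf_convolution a0 b0 ab1); apply: eq_integral => x _;
     rewrite -EFinM mulrC.
apply: (@le_lt_trans _ _ (\int[gamma]_x 1)).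
  apply: ge0_le_integral => //.
  - exact: measurableT_comp.
  - move=> x _; have /andP[u0 u1] := F_Cauchy01 ((t - a * x) / b).
    by rewrite /= lee_fin ger0_norm ltW.
rewrite integral_cst// mul1e [ltLHS](_ : _ = 1) ?ltry//.
exact: integral_cauchy_pdf.
Qed.

End cauchy_stable.

Section independent_pair.
Context {R : realType} d (T : measurableType d) (P : probability T R).
Local Open Scope ereal_scope.

(* Conditionally on [E], the law of [(X, Y)] agrees with the product of the laws
   on rectangles. *)
Lemma product_law (X Y : {RV P >-> R}) (E : set T) (Z : set (R * R)) :
  measurable E ->
  (forall A B, measurable A -> measurable B ->
    P (X @^-1` A `&` Y @^-1` B `&` E) = P (X @^-1` A) * P (Y @^-1` B) * P E) ->
  measurable Z ->
  P ([set w | Z (X w, Y w)] `&` E) =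
    (distribution P X \x distribution P Y) Z * P E.
Proof.
move=> mE indep mZ.
have mXY : measurable_fun setT (fun w => (X w, Y w)) by exact: measurable_fun_pair.
pose XY : {mfun T >-> (R * R)%type} :=
  HB.pack (fun w => (X w, Y w)) (isMeasurableFun.Build _ _ _ _ _ mXY).
have PEfin : P E \is a fin_num by exact: fin_num_measure.
(* Conditioning divides by [P E], so a null [E] is treated apart: both sides vanish. *)
have [PE0|PE0] := eqVneq (P E) 0.
  rewrite PE0 mule0; apply: (subset_measure0 _ _ _ PE0) => //.
  by apply: measurableI => //; rewrite -[X in measurable X]setTI; exact: (mXY measurableT Z mZ).
(* [mnormalize] falls back on its second argument for mass [0] or [+oo]; neither occurs here, so it
   is the conditional probability given [E]. *)
have nE A : mnormalize (mrestr P mE) P A = P (A `&` E) * ((fine (P E))^-1)%:E.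
  have eE : mrestr P mE setT = P E by rewrite /mrestr setTI.
  rewrite /mnormalize /= eE (negbTE PE0) /= ifF//.
  by apply: negbTE; rewrite -ltey -ge0_fin_numE.
have dE B : distribution (mnormalize (mrestr P mE) P) XY B =
    P ((fun w => (X w, Y w)) @^-1` B `&` E) * ((fine (P E))^-1)%:E by exact: nE.
rewrite (product_measure_unique (m' := distribution (mnormalize (mrestr P mE) P) XY))//.
  rewrite [X in _ = X * _](dE Z) -muleA.
  rewrite -[X in _ * (_ * X)](fineK PEfin) -EFinM mulVf ?mule1//.
  by rewrite fine_eq0.
move=> A B mA mB; apply: etrans (dE _) _.
rewrite [X in P (X `&` E)](_ : _ = X @^-1` A `&` Y @^-1` B)//.
rewrite indep// -muleA -[X in _ * (X * _) = _](fineK PEfin) -EFinM divff ?mule1//.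
by rewrite fine_eq0.
Qed.

End independent_pair.

(** * Weighted means of two variables dominating [G] *)

Section skew_cauchy.
Context {R : realType}.
Notation gamma := (@cauchy_prob R).

Lemma distribution_function01 (G : R -> R) t : is_distribution_function G ->
  0 <= G t <= 1.
Proof.
move=> [Gnd _ GNy Gy]; apply/andP; split.
  apply: (cvgr_to_le GNy); near=> x; apply: Gnd; near: x.
  exact: (nbhs_ninfty_le (num_real t)).
apply: (cvgr_to_ge Gy); near=> x; apply: Gnd; near: x.
exact: (nbhs_pinfty_ge (num_real t)).
Unshelve. all: end_near. Qed.

Lemma F_Cauchy_lt : {homo @F_Cauchy R : x y / x < y}.
Proof.
move=> x y xy; rewrite /F_Cauchy ltrD2r ltr_pM2l ?invr_gt0 ?pi_gt0//.
exact: lt_atan.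
Qed.

Lemma F_Cauchy_surj (u : R) : 0 < u < 1 -> exists c, F_Cauchy c = u.
Proof.
move=> /andP[u0 u1]; exists (tan (pi * (u - 2^-1))).
have pi0 := @pi_gt0 R.
rewrite /F_Cauchy tanK ?mulKf ?gt_eqF//; first by rewrite subrK.
rewrite in_itv /= -mulrN !ltr_pM2l//; apply/andP; split; lra.
Qed.

(** The probability integral transform, for a bare set function so that it serves both [gamma] and
    its square. [F_Cauchy] never takes the values [0] and [1], so these [u] are treated apart. *)
Lemma cauchy_transform T (m : set T -> \bar R) (Y : T -> R) u :
  m set0 = 0%E -> m setT = 1%E ->
  (forall c, m [set w | Y w <= c] = (F_Cauchy c)%:E) ->
  0 <= u <= 1 -> m [set w | F_Cauchy (Y w) <= u] = u%:E.
Proof.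
move=> m0 mT mY /andP[u0 u1].
have [->|un0] := eqVneq u 0.
  rewrite (_ : mkset _ = set0)//; apply/seteqP; split => // w /=.
  by rewrite leNgt => /negP; apply; case/andP: (F_Cauchy01 (Y w)).
have [->|un1] := eqVneq u 1.
  rewrite (_ : mkset _ = setT)//; apply/seteqP; split => // w _ /=.
  by apply: ltW; case/andP: (F_Cauchy01 (Y w)).
have [|c <-] := @F_Cauchy_surj u; first by rewrite !lt_neqAle u0 u1 eq_sym un0 un1.
rewrite -mY; congr (m _); apply/seteqP; split => w /=; last exact: F_Cauchy_nd.
by rewrite leNgt => h; rewrite leNgt; apply: contra h; exact: F_Cauchy_lt.
Qed.

Variable G : R -> R.
Hypothesis SG : S_C G.

Let Gd : is_distribution_function G. Proof. by case: SG. Qed.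

Let h (x : measurableTypeR R) : R := ginv G (F_Cauchy x).

Let h_leP x t : (h x <= t) = (F_Cauchy x <= G t).
Proof. by rewrite ginv_leP// F_Cauchy01. Qed.

Let mh : measurable_fun setT h.
Proof.
apply: (@nondecreasing_measurable R) => // x y xy.
have /andP[? _] := F_Cauchy01 x; have /andP[_ ?] := F_Cauchy01 y.
by apply: ginv_nd => //; exact: F_Cauchy_nd.
Qed.

Let hmf : {mfun (measurableTypeR R) >-> R} :=
  HB.pack h (isMeasurableFun.Build _ _ _ _ _ mh).

Let nu : probability R R := distribution gamma hmf.

(** [h x <= t] means [F_Cauchy x <= G t], and [F_Cauchy] of a Cauchy variable is uniform. *)
Let nu_itv t : nu `]-oo, t]%classic = (G t)%:E.
Proof.
rewrite -(@cauchy_transform _ gamma id (G t))//.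
- congr (gamma _); apply/seteqP; split => x /=; rewrite in_itv/= h_leP//.
- exact: integral_cauchy_pdf.
- move=> c; rewrite -integralNy_cauchy_pdf; congr (gamma _).
- exact: distribution_function01.
Qed.

Variables a b : R.

Lemma skew_cauchy_pair (m0 m1 : probability R R) t :
  0 < a -> 0 < b -> a + b = 1 ->
  (forall s, (m0 `]-oo, s]%classic <= (G s)%:E)%E) ->
  (forall s, (m1 `]-oo, s]%classic <= (G s)%:E)%E) ->
  ((m0 \x m1) (sum_le a b (@id R) t) <= (G t)%:E)%E.
Proof.
move=> a0 b0 ab1 m0G m1G.
apply: (@le_trans _ _ ((nu \x nu) (sum_le a b (@id R) t))%E).
  by apply: product_sum_le_homo => // s; rewrite nu_itv.
have mhh : measurable_fun setT (fun z : measurableTypeR R * measurableTypeR R => (h z.1, h z.2)).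
  by apply: measurable_fun_pair; apply: measurableT_comp.
pose hh : {mfun (measurableTypeR R * measurableTypeR R)%type >-> (R * R)%type} :=
  HB.pack (fun z => (h z.1, h z.2)) (isMeasurableFun.Build _ _ _ _ _ mhh).
(* The square of [nu] is the image under [hh] of the square of [gamma], as they agree on
   rectangles. *)
rewrite (product_measure_unique (m' := pushforward (gamma \x gamma)%E hh)); last 2 first.
- move=> A B mA mB.
  have := mh measurableT mA; rewrite setTI => mhA.
  have := mh measurableT mB; rewrite setTI => mhB.
  exact: (@product_measure1E _ _ _ _ _ gamma gamma _ _ mhA mhB).
- exact: (@measurable_sum_le _ a b _ R id t (@measurable_id _ _ setT)).
(* By stability [a * z.1 + b * z.2] is Cauchy, so [G t] is the measure of the event
   [F_Cauchy (a * z.1 + b * z.2) <= G t]; convexity of [h] puts [sum_le a b h t] inside it. *)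
rewrite -(@cauchy_transform _ (gamma \x gamma)%E (fun z => a * z.1 + b * z.2) (G t))//.
- apply: (@le_measure _ _ _ (gamma \x gamma)%E (sum_le a b h t)); rewrite ?inE.
  + exact: (@measurable_sum_le _ a b _ _ h t).
  + pose mR := measurableTypeR R.
    have mz1 : measurable_fun setT (fun z : mR * mR => z.1 : R) by exact: measurable_fst.
    have mz2 : measurable_fun setT (fun z : mR * mR => z.2 : R) by exact: measurable_snd.
    have mF : measurable_fun setT (fun z : mR * mR => F_Cauchy (a * z.1 + b * z.2)).
      apply: measurableT_comp.
        by apply: nondecreasing_measurable => //; exact: F_Cauchy_nd.
      by apply: measurable_funD; exact: measurable_funM.
    by have := mF measurableT `]-oo, G t]%classic (measurable_itv _); rewrite setTI.
  + move=> z; rewrite /pushforward /sum_le /= => hz; rewrite -h_leP.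
    apply: le_trans hz; have bE : b = 1 - a by rewrite -ab1 [a + b]addrC addrK.
    have a1 : a <= 1 by rewrite -ab1 lerDl ltW.
    have [_ cvx] := SG; rewrite bE.
    exact: (cvx z.1 z.2 a (F_Cauchy01 _) (F_Cauchy01 _) (ltW a0) a1).
- rewrite -setXTT product_measure1E//.
  exact: (etrans (congr2 mule integral_cauchy_pdf integral_cauchy_pdf) (mule1 _)).
- by move=> c; exact: cauchy_stable.
- exact: distribution_function01.
Qed.

End skew_cauchy.

(** * Convex combinations *)

Section ord_cons.

(** Prepends to a family indexed by ordinals, the form in which [mutually_independent] takes its
    variables. *)
Definition ocons A n (x : A) (f : 'I_n -> A) (i : 'I_n.+1) : A :=
  oapp f x (unlift ord0 i).

Lemma ocons0 A n (x : A) (f : 'I_n -> A) : ocons x f ord0 = x.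
Proof. by rewrite /ocons unlift_none. Qed.

Lemma oconsS A n (x : A) (f : 'I_n -> A) i : ocons x f (lift ord0 i) = f i.
Proof. by rewrite /ocons liftK. Qed.

Lemma bigcap_ord_recl T n (F : 'I_n.+1 -> set T) :
  \bigcap_(i in [set: 'I_n.+1]) F i =
  F ord0 `&` \bigcap_(i in [set: 'I_n]) F (lift ord0 i).
Proof.
apply/seteqP; split => w.
  by move=> Fw; split; [exact: Fw|move=> i _; exact: Fw].
move=> [F0 FS] i _; case: (unliftP ord0 i) => [j ->|->//].
exact: FS.
Qed.

End ord_cons.

(** * Merging the first two of several independent variables *)

Section merge.
Context {R : realType} d (T : measurableType d) (P : probability T R).
Variables (n : nat) (X : 'I_n.+2 -> {RV P >-> R}).
Hypothesis indepX : mutually_independent X.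
Local Open Scope ereal_scope.

Let X0 := X ord0.
Let X1 := X (lift ord0 ord0).
Let XS (i : 'I_n) := X (lift ord0 (lift ord0 i)).

(** An instance of [product_law], with [E] the event that the remaining variables lie in their sets
    [B]. *)
Lemma product_law_first_two (Z : set (R * R)) (B : 'I_n -> set R) :
  measurable Z -> (forall i, measurable (B i)) ->
  P ([set w | Z (X0 w, X1 w)] `&` \bigcap_(i in [set: 'I_n]) (XS i @^-1` B i)) =
  (distribution P X0 \x distribution P X1) Z * \prod_(i < n) P (XS i @^-1` B i).
Proof.
move=> mZ mB.
have indep A0 A1 : measurable A0 -> measurable A1 ->
    P (X0 @^-1` A0 `&` (X1 @^-1` A1 `&` \bigcap_(i in [set: 'I_n]) (XS i @^-1` B i))) =
    P (X0 @^-1` A0) * (P (X1 @^-1` A1) * \prod_(i < n) P (XS i @^-1` B i)).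
  move=> mA0 mA1; have := indepX (B := ocons A0 (ocons A1 B)).
  rewrite !bigcap_ord_recl !big_ord_recl !(ocons0, oconsS).
  under eq_bigcapr do rewrite !oconsS.
  under eq_bigr do rewrite !oconsS.
  apply => i; case: (unliftP ord0 i) => [j ->|->]; rewrite ?ocons0 ?oconsS//.
  by case: (unliftP ord0 j) => [k ->|->]; rewrite ?ocons0 ?oconsS.
(* Taking the whole line for the first two sets leaves the independence of the others. *)
have PE : P (\bigcap_(i in [set: 'I_n]) (XS i @^-1` B i)) = \prod_(i < n) P (XS i @^-1` B i).
  have := indep setT setT measurableT measurableT.
  by rewrite !preimage_setT !setTI probability_setT !mul1e.
rewrite -PE; apply: product_law => //.
- apply: fin_bigcap_measurable => // i _.
  by rewrite -[X in measurable X]setTI; exact: measurable_funPT.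
- by move=> A0 A1 mA0 mA1; rewrite PE -setIA indep// muleA.
Qed.

Lemma pair_law (Z : set (R * R)) : measurable Z ->
  P [set w | Z (X0 w, X1 w)] = (distribution P X0 \x distribution P X1) Z.
Proof.
move=> mZ; have := product_law_first_two mZ (fun=> measurableT).
rewrite (_ : \bigcap_(i in _) _ = setT).
  rewrite setIT => ->; rewrite big1 ?mule1// => i _.
  by rewrite preimage_setT probability_setT.
by apply/seteqP; split.
Qed.

(** An event on [Y] is an event on the pair [(X0, X1)], in general not a rectangle, hence the appeal
    to [product_law_first_two]. *)
Lemma merge_independent (Y : {RV P >-> R}) (phi : R * R -> R) :
  measurable_fun setT phi -> (forall w, Y w = phi (X0 w, X1 w)) ->
  mutually_independent (ocons Y XS).
Proof.
move=> mphi YE B mB.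
have pre (A : set R) : Y @^-1` A = [set w | (phi @^-1` A) (X0 w, X1 w)].
  by apply/funext => w; rewrite /preimage/= YE.
have mpre (A : set R) : measurable A -> measurable (phi @^-1` A).
  by move=> mA; rewrite -[X in measurable X]setTI; exact: mphi.
rewrite bigcap_ord_recl big_ord_recl !ocons0 pre.
under eq_bigcapr do rewrite oconsS.
under eq_bigr do rewrite oconsS.
rewrite product_law_first_two//; last exact: mpre.
congr (_ * _).
by rewrite pair_law//; exact: mpre.
Qed.

End merge.

Section convex_combinations.
Context {R : realType}.
Variable G : R -> R.
Hypothesis SG : S_C G.
Local Open Scope ereal_scope.

(** The induction asks only that each variable dominate [G]: a merged variable does, but need not
    have law [G]. *)
Lemma skew_cauchy_sum d (T : measurableType d) (P : probability T R)
  n (X : 'I_n.+1 -> {RV P >-> R}) (theta : 'I_n.+1 -> R) t :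
  mutually_independent X ->
  (forall i s, P [set w | (X i w <= s)%R] <= (G s)%:E) ->
  (forall i, 0 <= theta i)%R -> (\sum_(i < n.+1) theta i = 1)%R ->
  P [set w | (\sum_(i < n.+1) theta i * X i w <= t)%R] <= (G t)%:E.
Proof.
elim: n X theta => [|n IH] X theta indepX XG theta0 theta1.
  move: theta1; rewrite big_ord1 => th1.
  rewrite (_ : mkset _ = [set w | (X ord0 w <= t)%R])//.
  by apply/funext => w; rewrite /= big_ord1 th1 mul1r.
pose s := (theta ord0 + theta (lift ord0 ord0))%R.
have [a [b [a0 b0 ab1 sa sb]]] : exists a b : R,
    [/\ 0 <= a, 0 <= b, a + b = 1, s * a = theta ord0 & s * b = theta (lift ord0 ord0)]%R.
  (* If both weights vanish, any convex pair serves for [a] and [b]. *)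
  have [s0|s0] := eqVneq s 0%R.
    exists 1%R, 0%R; have := theta0 ord0; have := theta0 (lift ord0 ord0).
    by move: s0; rewrite /s => s0 h1 h0; split; lra.
  exists (theta ord0 / s)%R, (theta (lift ord0 ord0) / s)%R; split.
  - by rewrite divr_ge0// addr_ge0.
  - by rewrite divr_ge0// addr_ge0.
  - by rewrite -mulrDl divff.
  - by rewrite mulrC divfK.
  - by rewrite mulrC divfK.
pose phi (z : R * R) := (a * z.1 + b * z.2)%R.
have mphi : measurable_fun setT phi.
  by apply: measurable_funD; apply: measurable_funM.
pose X0 := X ord0; pose X1 := X (lift ord0 ord0).
have mY : measurable_fun setT (fun w => phi (X0 w, X1 w)).
  by apply: (measurableT_comp mphi); exact: measurable_fun_pair.
pose Y : {RV P >-> R} := HB.pack (fun w => phi (X0 w, X1 w))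
  (isMeasurableFun.Build _ _ _ _ _ mY).
pose XS (i : 'I_n) := X (lift ord0 (lift ord0 i)).
have indepY := @merge_independent _ _ _ _ _ _ indepX Y phi mphi (fun=> erefl).
rewrite (_ : mkset _ = [set w | (\sum_(i < n.+1)
    ocons s (fun i => theta (lift ord0 (lift ord0 i))) i * ocons Y XS i w <= t)%R]); last first.
  apply/funext => w; rewrite /= !big_ord_recl !ocons0 addrA; congr (_ + _ <= _)%R.
    by rewrite -sa -sb -!mulrA -mulrDr.
  by apply: eq_bigr => i _; rewrite !oconsS.
apply: IH => //.
- move=> i u; case: (unliftP ord0 i) => [j ->|->]; rewrite ?oconsS ?ocons0; first exact: XG.
  have YE w : Y w = (a * X0 w + b * X1 w)%R by [].
  (* [skew_cauchy_pair] takes positive weights; with a zero weight [Y] is one of the two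
     variables. *)
  have [a00|an0] := eqVneq a 0%R.
    rewrite (_ : mkset _ = [set w | (X1 w <= u)%R]); first exact: XG.
    by apply/funext => w; rewrite /mkset YE a00 mul0r add0r (_ : b = 1%R) ?mul1r//; lra.
  have [b00|bn0] := eqVneq b 0%R.
    rewrite (_ : mkset _ = [set w | (X0 w <= u)%R]); first exact: XG.
    by apply/funext => w; rewrite /mkset YE b00 mul0r addr0 (_ : a = 1%R) ?mul1r//; lra.
  rewrite (_ : mkset _ = [set w | sum_le a b (@id R) u (X0 w, X1 w)])//.
  rewrite pair_law//; last exact: (@measurable_sum_le _ a b _ R id u (@measurable_id _ _ setT)).
  apply: (skew_cauchy_pair SG) => //.
  - by rewrite lt_neqAle eq_sym an0.
  - by rewrite lt_neqAle eq_sym bn0.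
  - by move=> v; apply: le_trans (XG ord0 v).
  - by move=> v; apply: le_trans (XG (lift ord0 ord0) v).
- move=> i; case: (unliftP ord0 i) => [j ->|->]; rewrite ?oconsS ?ocons0//.
  exact: addr_ge0.
- rewrite big_ord_recl ocons0 -theta1 !big_ord_recl addrA; congr (_ + _)%R.
  by apply: eq_bigr => i _; rewrite oconsS.
Qed.

Lemma S_C_sub_D_minus : D_minus G.
Proof.
move=> n theta theta0 theta1 d T P X indepX XG t; rewrite XG.
by apply: skew_cauchy_sum => // i s; rewrite XG.
Qed.

End convex_combinations.

Theorem theorem7 (R : realType) :
  [/\ @S_P R `<=` @S_F R, @S_F R `<=` @S_C R & @S_C R `<=` [set G | @D_minus R G]].
Proof.
split; [exact: S_P_sub_S_F|exact: S_F_sub_S_C|move=> G; exact: S_C_sub_D_minus].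
Qed.
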